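(* Let $(r_k)_{k\in\mathbb{Z}}$ be the integer sequence defined by $r_k=0$ for $k<0$, $r_0=1$, and $$r_k=\sum_{\nu=1}^{\infty}(-1)^{\nu-1}(2\nu+1)\,r_{k-\nu(\nu+1)/2}\qquad (k\geq 1).$$ Then: (1) The integer sequences $\{r_k\}$ ($k\geq 0$), $\{r_{k+1}-r_k\}$ ($k\geq 0$) and $\{r_{k+2}-2r_{k+1}+r_k\}$ ($k\geq 1$) are increasing. (2) The radius of convergence of the power series $1+\sum_{k=1}^{\infty}r_kq^k$ (in the variable $q$) equals $1$.
   Context: The sum over $\nu$ in the recurrence is finite for each $k$, since $r_k=0$ for $k<0$. The first values are $r_0=1$, $r_1=3$, $r_2=9$, $r_3=22$, $r_4=51$, $r_5=108$. *)

(* Defs.v *)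
From Stdlib Require Import Reals ZArith Lia.
From Coquelicot Require Import Coquelicot.

(* The summation index nu = 1, 2, ... is shifted to n = nu - 1 = 0, 1, ... *)
Definition recurrence_term (r : Z -> Z) (k : Z) (n : nat) : Z :=
  let nu := Z.of_nat (S n) in
  ((-1) ^ (nu - 1) * (2 * nu + 1) * r (k - nu * (nu + 1) / 2))%Z.

(* The infinite sum is the sum of a series in R; the terms vanish once
   nu (nu + 1) / 2 > k, so it always converges to a finite integer sum. *)
Definition is_r_sequence (r : Z -> Z) : Prop :=
  (forall k : Z, (k < 0)%Z -> r k = 0%Z) /\
  r 0%Z = 1%Z /\
  (forall k : Z, (1 <= k)%Z ->
     is_series (fun n : nat => IZR (recurrence_term r k n)) (IZR (r k))).

(* Strictly increasing on the index range [m, +oo). *)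
Definition increasing_from (m : Z) (f : Z -> Z) : Prop :=
  forall j k : Z, (m <= j)%Z -> (j < k)%Z -> (f j < f k)%Z.

Fixpoint Zsum (f : nat -> Z) (n : nat) : Z :=
  match n with O => 0%Z | S m => (Zsum f m + f m)%Z end.

Lemma Zsum_ext (f g : nat -> Z) (n : nat) :
  (forall i, (i < n)%nat -> f i = g i) -> Zsum f n = Zsum g n.
Proof.
  induction n as [|n IH]; intros H; simpl; [reflexivity|].
  rewrite IH, H; auto with arith.
Qed.

Lemma Zsum_stable (f : nat -> Z) (N n : nat) :
  (forall i, (N <= i)%nat -> f i = 0%Z) -> (N <= n)%nat -> Zsum f n = Zsum f N.
Proof.
  intros H Hn; induction Hn as [|n Hn IH]; simpl; [reflexivity|].
  rewrite IH, H by assumption; lia.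
Qed.

Lemma sum_n_Zsum (f : nat -> Z) (n : nat) :
  sum_n (fun i => IZR (f i)) n = IZR (Zsum f (S n)).
Proof.
  induction n as [|n IH].
  - rewrite sum_O; reflexivity.
  - rewrite sum_Sn, IH; change plus with Rplus; rewrite <- plus_IZR; reflexivity.
Qed.

Lemma is_series_Zsum (f : nat -> Z) (N : nat) :
  (forall i, (N <= i)%nat -> f i = 0%Z) ->
  is_series (fun i => IZR (f i)) (IZR (Zsum f N)).
Proof.
  intros H.
  apply (filterlim_ext_loc (fun _ : nat => IZR (Zsum f N))).
  - exists N; intros n Hn; rewrite sum_n_Zsum.
    rewrite (Zsum_stable f N (S n)); auto with arith.
  - apply filterlim_const.
Qed.

Lemma triangle_ge (n : nat) :
  (Z.of_nat (S n) <= Z.of_nat (S n) * (Z.of_nat (S n) + 1) / 2)%Z.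
Proof. apply Z.div_le_lower_bound; nia. Qed.

Lemma recurrence_term_vanish (r : Z -> Z) (k : Z) (n : nat) :
  (forall j : Z, (j < 0)%Z -> r j = 0%Z) ->
  (k <= Z.of_nat n)%Z -> recurrence_term r k n = 0%Z.
Proof.
  intros H Hk; unfold recurrence_term; cbv zeta.
  rewrite H; [lia|]; pose proof (triangle_ge n); lia.
Qed.

Lemma is_r_sequence_Zsum (r : Z -> Z) :
  (forall k : Z, (k < 0)%Z -> r k = 0%Z) ->
  forall k : Z,
  is_series (fun n : nat => IZR (recurrence_term r k n))
            (IZR (Zsum (recurrence_term r k) (Z.to_nat k))).
Proof.
  intros H k; apply is_series_Zsum; intros i Hi.
  apply recurrence_term_vanish; [exact H | lia].
Qed.

Fixpoint r_fuel (fuel : nat) (k : Z) : Z :=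
  match fuel with
  | O => 0%Z
  | S fuel' =>
      if (k <? 0)%Z then 0%Z else if (k =? 0)%Z then 1%Z
      else Zsum (recurrence_term (r_fuel fuel') k) (Z.to_nat k)
  end.

Lemma r_fuel_indep (a b : nat) (k : Z) :
  (k < Z.of_nat a)%Z -> (k < Z.of_nat b)%Z -> r_fuel a k = r_fuel b k.
Proof.
  revert b k; induction a as [|a IH]; intros [|b] k Ha Hb; cbn [r_fuel]; auto;
    destruct (Z.ltb_spec k 0); auto; destruct (Z.eqb_spec k 0); auto; try lia.
  apply Zsum_ext; intros i Hi; unfold recurrence_term; cbv zeta; f_equal.
  pose proof (triangle_ge i); apply IH; lia.
Qed.

Lemma r_sequence_exists : exists r : Z -> Z, is_r_sequence r.
Proof.
  exists (fun k => r_fuel (S (Z.to_nat k)) k).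
  assert (Hneg : forall k : Z, (k < 0)%Z -> r_fuel (S (Z.to_nat k)) k = 0%Z).
  { intros k Hk; cbn [r_fuel]; destruct (Z.ltb_spec k 0); [reflexivity | lia]. }
  split; [exact Hneg | split; [reflexivity |]].
  intros k Hk.
  replace (r_fuel (S (Z.to_nat k)) k)
    with (Zsum (recurrence_term (fun k => r_fuel (S (Z.to_nat k)) k) k) (Z.to_nat k)).
  { apply is_r_sequence_Zsum, Hneg. }
  cbn [r_fuel]; symmetry.
  destruct (Z.ltb_spec k 0); [lia|]; destruct (Z.eqb_spec k 0); [lia|].
  apply Zsum_ext; intros i Hi; unfold recurrence_term; cbv zeta; f_equal.
  pose proof (triangle_ge i).
  set (j := (k - _ / 2)%Z) in *.
  refine (r_fuel_indep (Z.to_nat k) (S (Z.to_nat j)) j _ _); lia.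
Qed.

Lemma r_sequence_unique (r s : Z -> Z) :
  is_r_sequence r -> is_r_sequence s -> forall k : Z, r k = s k.
Proof.
  intros [Hr [Hr0 Hrk]] [Hs [Hs0 Hsk]].
  assert (E : forall t, (forall k : Z, (k < 0)%Z -> t k = 0%Z) ->
    (forall k : Z, (1 <= k)%Z ->
       is_series (fun n : nat => IZR (recurrence_term t k n)) (IZR (t k))) ->
    forall k : Z, (1 <= k)%Z -> t k = Zsum (recurrence_term t k) (Z.to_nat k)).
  { intros t Ht Htk k Hk; apply eq_IZR.
    rewrite <- (is_series_unique _ _ (Htk k Hk)).
    apply is_series_unique, is_r_sequence_Zsum, Ht. }
  assert (Q : forall (m : nat) (k : Z), (k < Z.of_nat m)%Z -> r k = s k).
  { induction m as [|m IH]; intros k Hk; [rewrite Hr, Hs by lia; reflexivity|].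
    destruct (Z.lt_ge_cases k 1) as [H|H].
    - destruct (Z.eq_dec k 0) as [->|H']; [congruence|].
      rewrite Hr, Hs by lia; reflexivity.
    - rewrite (E r Hr Hrk), (E s Hs Hsk) by assumption.
      apply Zsum_ext; intros i Hi; unfold recurrence_term; cbv zeta; f_equal.
      pose proof (triangle_ge i); apply IH; lia. }
  intros k; apply (Q (S (Z.to_nat k))); lia.
Qed.

Example r_first_values :
  (r_fuel 6 0, r_fuel 6 1, r_fuel 6 2, r_fuel 6 3, r_fuel 6 4, r_fuel 6 5)%Z
  = (1, 3, 9, 22, 51, 108)%Z.
Proof. reflexivity. Qed.

(* Main.v *)
From mathcomp Require Import all_boot all_algebra.
From mathcomp Require Import ssrZ zify.
Require Import Defs.
From Stdlib Require Import Reals ZArith Lra.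
From Coquelicot Require Import Coquelicot.

Import GRing.Theory.

(** Jacobi's identity
      prod_(n >= 1) (1 - q^n)^3
        = sum_(k >= 0) (-1)^k (2k + 1) q^(k(k+1)/2)
    turns the recurrence into the statement that r_k is the k-th coefficient of
    F = prod_(n >= 1) (1 - q^n)^(-3). Both claims can be read off that product.

    Monotonicity. The factor n = 1 of F is exactly (1 - q)^(-3), so the third
    differences of r are the coefficients of
    G = prod_(n >= 2) (1 - q^n)^(-3), a product of geometric series: they are
    nonnegative, and the factor 1 / (1 - q^k) already contributes a term q^k,
    so the k-th one is positive for k >= 2 ([third_difference]). Summing up
    from the zeros of r at negative indices makes the second differences, the
    first differences and r itself increase.

    Radius of convergence. It is at most 1 because r_k >= 1. Conversely, for
    0 < x < 1 all terms of F(x) are nonnegative, so r_k x^k <= F(x), and the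
    product F(x) converges: 1 / (1 - x^n) <= exp (x^n / (1 - x)), and the sum
    of the x^n is at most x / (1 - x). This bounds r_k x^k independently of k
    ([r_growth]).

    Everything is done with finite truncations. Jacobi's identity is needed
    only modulo q^(n+1), and there it follows from an exact polynomial identity
    ([Jacobi_finite]), a finite form of the triple product identity
    differentiated at z = 1. Division by 1 - q^n is expressed through the
    relation b_k = a_k - a_(k-n) between coefficient sequences: a property of b
    up to index N is transferred to a by induction on the index. *)

(** * A finite form of Jacobi's identity *)

Section Jacobi.
From mathcomp Require Import ring.
Local Open Scope ring_scope.
Context {R : comNzRingType} (q : R).

Definition qprod (a b : nat) : R := \prod_(a <= i < b) (1 - q ^+ i).

Lemma qprod_recr a b : (a <= b)%nat -> qprod a b.+1 = qprod a b * (1 - q ^+ b).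
Proof. exact: big_nat_recr. Qed.

Lemma qprod_recl a b : (a < b)%nat -> qprod a b = (1 - q ^+ a) * qprod a.+1 b.
Proof. exact: big_ltn. Qed.

Lemma qprod_geq a b : (b <= a)%nat -> qprod a b = 1.
Proof. exact: big_geq. Qed.

Lemma qprod_id a : qprod a a = 1.
Proof. exact: qprod_geq. Qed.

Lemma qprod0 b : (0 < b)%nat -> qprod 0 b = 0.
Proof. by move=> b_gt0; rewrite qprod_recl // expr0 subrr mul0r. Qed.

(** Holds because every factor is 1 modulo q^a. *)
Lemma qprod_modX a b : exists w, qprod a b = 1 + q ^+ a * w.
Proof.
case: (leqP b a) => [/qprod_geq ->|/ltnW]; first by exists 0; ring.
elim: b => [|b IHb] le_ab; first by exists 0; rewrite qprod_geq //; ring.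
case: (ltnP b a) => [lt_ba|{}le_ab].
  by exists 0; rewrite qprod_geq //; ring.
have [w Ew] := IHb le_ab.
rewrite qprod_recr // Ew -(subnKC le_ab) exprD.
by exists (w - q ^+ (b - a) - w * q ^+ a * q ^+ (b - a)); ring.
Qed.

(** The lists of exponents below enumerate each factor of the cubes one by one,
    so that the division by a cube becomes an induction over a list. *)
Lemma prod_triple b : let s := index_iota 1 b in
  \prod_(n <- s ++ s ++ s) (1 - q ^+ n) = qprod 1 b ^+ 3.
Proof. by rewrite /= !big_cat /= -/(qprod 1 b); ring. Qed.

Lemma prod_triple_tail b : (1 < b)%nat -> let s := index_iota 2 b in
  \prod_(n <- s ++ s ++ s ++ [:: 1; 1; 1]%nat) (1 - q ^+ n) = qprod 1 b ^+ 3.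
Proof.
move=> b_gt1; rewrite (qprod_recl 1) //= !big_cat !big_cons big_nil /=.
by rewrite -/(qprod 2 b); ring.
Qed.

(** The polynomial (q)_n (q)_(2n+1) / ((q)_(n-k) (q)_(n+k+1)), where (q)_m is
    the product of the 1 - q^i for 1 <= i <= m; it is (q)_n times the Gaussian
    binomial coefficient [2n+1, n-k]. For k > n the truncated subtraction
    n + 1 - k is 0, so the factor 1 - q^0 makes the value 0, as it should be. *)
Definition ratio (n k : nat) : R :=
  qprod (n.+1 - k) n.+1 * qprod (n + k).+2 (n + n).+2.

Definition jterm (n k : nat) : R := (-1) ^+ k * q ^+ 'C(k.+1, 2) * ratio n k.

Lemma jterm_gt n k : (n < k)%nat -> jterm n k = 0.
Proof.
move=> lt_nk; rewrite /jterm /ratio (_ : n.+1 - k = 0)%nat; last by lia.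
by rewrite qprod0 // mul0r mulr0.
Qed.

(** jterm n k is (q)_n times the coefficient of z^k in the Laurent polynomial
      prod_(1 <= i <= n) (1 - z q^i) prod_(0 <= i <= n) (1 - q^i / z).
    From n to n + 1 this polynomial gains the factor
    (1 - z Q) (1 - Q / z) = 1 + Q^2 - Q (z + 1 / z), where Q = q^(n+1), and
    (q)_n gains the factor 1 - Q; comparing coefficients of z^k gives the
    recurrence of [jterm_step]. The coefficients of z^k and z^(-1-k) are
    opposite, so for k = 0 the neighbour of index -1 is - jterm n 0. *)
Lemma jterm_step0 n :
  jterm n.+1 0 = (1 - q ^+ n.+1) *
    ((1 + q ^+ n.+1 ^+ 2) * jterm n 0 - q ^+ n.+1 * (jterm n 1 - jterm n 0)).
Proof.
case: n => [|n].
  rewrite [jterm 0 1]jterm_gt // /jterm /ratio !subn0 !addn0.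
  rewrite !qprod_id (qprod_recl 3) // (qprod_geq 4) //.
  by rewrite bin_small //; ring.
rewrite /jterm /ratio !subn0 subn1 !addn0 !addn1 [_.+1.-1]/=.
rewrite !qprod_id (qprod_recl n.+1) // qprod_id (qprod_recl n.+3); last by lia.
set e := (n.+1 + n.+1).+2.
rewrite (_ : (n.+2 + n.+2).+2 = e.+2); last by rewrite /e; lia.
rewrite (qprod_recr _ e.+1) ?(qprod_recr _ e); try (rewrite /e; lia).
set x := qprod _ e; rewrite (_ : e = n + n + 4)%nat; last by rewrite /e; lia.
by rewrite (@bin_small 1 2) // binn !(exprS, exprD); ring.
Qed.

(** What remains of [jterm_step] after cancelling common factors, with
    A = q^(n-k-1), C = q^(k+1) and Q = q^(n+1). *)
Lemma jterm_core (A C Q : R) : Q = q * A * C ->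
  - C * ((1 - Q ^+ 2) * (1 - q * Q ^+ 2)) =
  - C * (1 + Q ^+ 2) * (1 - q * A) * (1 - q * Q * C)
  - Q * ((1 - Q * C) * (1 - q * Q * C) + q * C ^+ 2 * (1 - A) * (1 - q * A)).
Proof. by move=> ->; ring. Qed.

Lemma jterm_step n k :
  jterm n.+1 k.+1 = (1 - q ^+ n.+1) *
    ((1 + q ^+ n.+1 ^+ 2) * jterm n k.+1
     - q ^+ n.+1 * (jterm n k + jterm n k.+2)).
Proof.
have binT j : 'C(j.+2, 2) = ('C(j.+1, 2) + j.+1)%nat by rewrite binS bin1.
case: (ltngtP n k) => [lt_nk|lt_kn|<-{k}].
- by rewrite !jterm_gt; try lia; ring.
- (* Splitting off the factors shared by the neighbouring terms requires
     k + 1 < n; for n = k + 1 some of these products are too short. *)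
  case: (ltngtP n k.+1) => [||Enk]; first by lia.
  + move=> {}lt_kn; have [m ->] : exists m, n = (k + m).+2.
      by exists (n - k.+2)%nat; lia.
    rewrite /jterm /ratio !binT.
    rewrite (_ : _ - k.+1 = m.+3)%nat; last by lia.
    rewrite (_ : _ - k.+1 = m.+2)%nat; last by lia.
    rewrite (_ : _ - k = m.+3)%nat; last by lia.
    rewrite (_ : _ - k.+2 = m.+1)%nat; last by lia.
    rewrite (qprod_recl m.+1) ?(qprod_recl m.+2); try lia.
    rewrite qprod_recr; try lia.
    set x := qprod m.+3 _.
    have [e Ee] : exists e, e = (k + k + m + 4)%nat by eexists.
    have [d Ed] : exists d, d = (k + k + m + m + 6)%nat by eexists.
    rewrite (_ : ((k + m).+3 + k.+1).+2 = e.+2); last by lia.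
    rewrite (_ : ((k + m).+2 + k).+2 = e); last by lia.
    rewrite (_ : ((k + m).+2 + k.+1).+2 = e.+1); last by lia.
    rewrite (_ : ((k + m).+2 + k.+2).+2 = e.+2); last by lia.
    rewrite (_ : ((k + m).+3 + (k + m).+3).+2 = d.+2); last by lia.
    rewrite (_ : ((k + m).+2 + (k + m).+2).+2 = d); last by lia.
    rewrite (qprod_recl e) ?(qprod_recl e.+1); try lia.
    rewrite (qprod_recr _ d.+1) ?(qprod_recr _ d); try lia.
    set y := qprod e.+2 d.
    have EQ : q ^+ (k + m).+3 = q * q ^+ m.+1 * q ^+ k.+1.
      by rewrite -exprS -exprD; congr (_ ^+ _); lia.
    have := jterm_core _ _ _ EQ.
    rewrite (_ : q ^+ e = q ^+ (k + m).+3 * q ^+ k.+1); last first.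
      by rewrite -exprD; congr (_ ^+ _); lia.
    rewrite (_ : q ^+ e.+1 = q * q ^+ (k + m).+3 * q ^+ k.+1); last first.
      by rewrite -exprS -exprD; congr (_ ^+ _); lia.
    rewrite (_ : q ^+ d = q ^+ (k + m).+3 ^+ 2); last first.
      by rewrite -exprM; congr (_ ^+ _); lia.
    rewrite (_ : q ^+ d.+1 = q * q ^+ (k + m).+3 ^+ 2); last first.
      by rewrite -exprM -exprS; congr (_ ^+ _); lia.
    move: 'C(k.+1, 2) => t.
    rewrite [q ^+ m.+2]exprS !exprD [q ^+ k.+2]exprS ![(-1) ^+ _.+1]exprS.
    move: (q ^+ m.+1) (q ^+ k.+1) (q ^+ (k + m).+3) => A C Q core.
    move: (q ^+ t) ((-1) ^+ k) => T s; clearbody x y.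
    transitivity (s * T * (1 - Q) * x * y *
      (- C * ((1 - Q ^+ 2) * (1 - q * Q ^+ 2)))); first by ring.
    by rewrite core; ring.
  + rewrite Enk [jterm k.+1 k.+2]jterm_gt //.
    rewrite /jterm /ratio !binT.
    rewrite (_ : k.+3 - k.+1 = 2)%nat; last by lia.
    rewrite (_ : k.+2 - k.+1 = 1)%nat; last by lia.
    rewrite (_ : k.+2 - k = 2)%nat; last by lia.
    rewrite (qprod_recl 1) // (qprod_recr 2 k.+2) //.
    set x := qprod 2 _.
    have [e Ee] : exists e, e = (k + k + 3)%nat by eexists.
    rewrite (_ : (k.+2 + k.+2).+2 = e.+3); last by lia.
    rewrite (_ : (k.+2 + k.+1).+2 = e.+2); last by lia.
    rewrite (_ : (k.+1 + k.+1).+2 = e.+1); last by lia.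
    rewrite (_ : (k.+1 + k).+2 = e); last by lia.
    rewrite (qprod_recl e.+2) // (qprod_recl e) // !qprod_id Ee.
    clearbody x; move: 'C(k.+1, 2) => t; rewrite !(exprS, exprD); ring.
- rewrite [jterm n n.+1]jterm_gt // [jterm n n.+2]jterm_gt //.
  rewrite /jterm /ratio binT !subSnn.
  rewrite !(qprod_geq _.+2); try lia.
  rewrite qprod_recr //; move: 'C(n.+1, 2) => t; rewrite !(exprS, exprD); ring.
Qed.

(** The weights 2k + 1 form an eigenvector of the recurrence:
    (1 + Q^2) (2k + 1) - Q ((2k + 3) + (2k - 1)) = (1 - Q)^2 (2k + 1); this is
    where differentiating in z enters, the term of index -1-k being merged with
    the one of index k. The sum is cut at any m so that induction on m proves it,
    at the price of the boundary term of the last line. *)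
Lemma jsum_step (m n : nat) :
  \sum_(k < m.+1) jterm n.+1 k *+ (2 * k + 1) =
  (1 - q ^+ n.+1) ^+ 3 * \sum_(k < m.+1) jterm n k *+ (2 * k + 1) +
  (1 - q ^+ n.+1) * q ^+ n.+1 *
    (jterm n m *+ (2 * m + 3) - jterm n m.+1 *+ (2 * m + 1)).
Proof.
elim: m => [|m IHm].
  by rewrite !big_ord_recr !big_ord0 /= jterm_step0; ring.
by rewrite big_ord_recr /= IHm [in RHS]big_ord_recr /= jterm_step; ring.
Qed.

Theorem Jacobi_finite n :
  qprod 1 n.+1 ^+ 3 = \sum_(k < n.+1) jterm n k *+ (2 * k + 1).
Proof.
elim: n => [|n IHn].
  by rewrite big_ord_recr big_ord0 /jterm /ratio /= !qprod_geq //; ring.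
rewrite jsum_step [jterm n n.+1]jterm_gt // [jterm n n.+2]jterm_gt //.
rewrite [in RHS]big_ord_recr /= [jterm n n.+1]jterm_gt // -IHn.
by rewrite qprod_recr //; ring.
Qed.

(** By [qprod_modX], ratio n k is 1 modulo q^(n+1-k), and the factor
    q^(k(k+1)/2) makes up for the missing q^k. *)
Theorem Jacobi_modX n : exists w, qprod 1 n.+1 ^+ 3 =
  \sum_(k < n.+1) (-1) ^+ k * q ^+ 'C(k.+1, 2) *+ (2 * k + 1) + q ^+ n.+1 * w.
Proof.
rewrite Jacobi_finite.
have jterm_modX k : (k < n.+1)%nat -> exists w, 
    jterm n k = (-1) ^+ k * q ^+ 'C(k.+1, 2) + q ^+ n.+1 * w.
  move=> lt_kn; rewrite /jterm /ratio.
  have [u ->] := qprod_modX (n.+1 - k) n.+1.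
  have [v ->] := qprod_modX (n + k).+2 (n + n).+2.
  have [d Ed] : exists d, 'C(k.+1, 2) = (k + d)%nat.
    by exists 'C(k, 2); rewrite binS bin1 addnC.
  rewrite Ed (_ : (n + k).+2 = (n.+1 - k) + (k + k.+1))%nat; last by lia.
  have -> : q ^+ n.+1 = q ^+ k * q ^+ (n.+1 - k) 
    by rewrite -exprD subnKC // ltnW.
  set m := (n.+1 - k)%nat.
  by exists ((-1) ^+ k * q ^+ d * (u + q ^+ (k + k.+1) * v + 
     u * q ^+ m * q ^+ (k + k.+1) * v)); rewrite !exprD; ring.
have partial m : (m <= n.+1)%nat -> exists w,
    \sum_(k < m) jterm n k *+ (2 * k + 1) =
    \sum_(k < m) (-1) ^+ k * q ^+ 'C(k.+1, 2) *+ (2 * k + 1) + q ^+ n.+1 * w.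
  elim: m => [|m IHm] le_m; first by exists 0; rewrite !big_ord0; ring.
  have [w Ew] := IHm (ltnW le_m); have [v Ev] := jterm_modX m le_m.
  by exists (w + v *+ (2 * m + 1)); rewrite !big_ord_recr /= Ew Ev; ring.
exact: partial.
Qed.
End Jacobi.

(** * Dividing coefficient sequences by 1 - q^n *)

Delimit Scope ring_scope with ring.

Section Coefficients.
From mathcomp Require Import ring.
Local Open Scope Z_scope.

(** Multiplication of the power series with coefficients a by 1 - q^n. *)
Definition sub_shift (n : nat) (a : nat -> Z) (k : nat) : Z :=
  a k - if (k < n)%nat then 0 else a (k - n)%nat.

Lemma foldr_sub_shift_poly (N : nat) (a : nat -> Z) (ns : seq nat) (k : nat) :
  (k <= N)%nat ->
  foldr sub_shift a ns k =
  ((\prod_(n <- ns) (1 - 'X^n) * \poly_(i < N.+1) a i)`_k)%ring.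
Proof.
elim: ns k => [|n ns IHns] k le_kN /=.
  by rewrite big_nil mul1r coef_poly ltnS le_kN.
rewrite big_cons -mulrA mulrBl mul1r coefB coefXnM /sub_shift IHns //.
by case: ltnP => // le_nk; rewrite IHns //; lia.
Qed.

Lemma sub_shift1 (f : Z -> Z) (k : nat) : (forall j, j < 0 -> f j = 0) ->
  sub_shift 1 (fun i => f (Z.of_nat i)) k = f (Z.of_nat k) - f (Z.of_nat k - 1).
Proof.
move=> f_neg; rewrite /sub_shift; case: ltnP => [lt_k1|lt_0k].
  by rewrite (f_neg (_ - 1)); lia.
by congr (_ - f _); lia.
Qed.

(** Division by 1 - q^n is multiplication by 1 + q^n + q^(2n) + ..., which can
    only increase nonnegative coefficients. *)
Lemma sub_shift_le (N n : nat) (a : nat -> Z) : (0 < n)%nat ->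
  (forall k, (k <= N)%nat -> 0 <= sub_shift n a k) ->
  forall k, (k <= N)%nat -> sub_shift n a k <= a k.
Proof.
move=> n_gt0 ge0; elim/ltn_ind => k IHk le_kN.
rewrite {1}/sub_shift; case: ltnP => [_|le_nk]; first by lia.
have lt_k : (k - n < k)%nat by lia.
have le_k : (k - n <= N)%nat by lia.
by have := IHk _ lt_k le_k; have := ge0 _ le_k; lia.
Qed.

Lemma foldr_sub_shift_le (N : nat) (a : nat -> Z) (ns : seq nat) :
  all (leq 1) ns ->
  (forall k, (k <= N)%nat -> 0 <= foldr sub_shift a ns k) ->
  forall k, (k <= N)%nat -> foldr sub_shift a ns k <= a k.
Proof.
elim: ns => [|n ns IHns] /=; first by move=> *; lia.
move=> /andP [n_gt0 ns_gt0] ge0 k le_kN.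
have le_c := sub_shift_le N n _ n_gt0 ge0.
apply: Z.le_trans (le_c k le_kN) _; apply: IHns => // j le_jN.
exact: Z.le_trans (ge0 j le_jN) (le_c j le_jN).
Qed.

(** Going back to a means multiplying by geometric series. The one for the
    exponent n has the term q^n; times the constant coefficients of the rest, it
    contributes at least 1 to a n, and no other contribution is negative. *)
Lemma foldr_sub_shift_gt0 (N : nat) (a : nat -> Z) (ns : seq nat) :
  all (leq 1) ns ->
  (forall k, (k <= N)%nat -> 0 <= foldr sub_shift a ns k) ->
  1 <= foldr sub_shift a ns 0%nat ->
  forall n, n \in ns -> (n <= N)%nat -> 1 <= a n.
Proof.
elim: ns => [//|m ns IHns] /= /andP [m_gt0 ns_gt0] ge0 ge1 n.
have le_c := sub_shift_le N m _ m_gt0 ge0.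
have c_ge0 j (le_jN : (j <= N)%nat) :=
  Z.le_trans _ _ _ (ge0 j le_jN) (le_c j le_jN).
have c0 : 1 <= foldr sub_shift a ns 0%nat.
  exact: Z.le_trans ge1 (le_c 0%nat (leq0n N)).
rewrite inE => /orP [/eqP ->|ns_n] le_nN; last exact: (IHns _ _ c0).
apply: Z.le_trans (foldr_sub_shift_le _ _ _ ns_gt0 c_ge0 _ le_nN).
by have := ge0 m le_nN; rewrite [sub_shift m _ m]/sub_shift ltnn subnn; lia.
Qed.

(** * The recurrence as a product formula *)

Lemma sum_Zsum (f : nat -> Z) (n : nat) : (\sum_(i < n) f i)%ring = Zsum f n.
Proof. by elim: n => [|n IHn]; rewrite ?big_ord0 // big_ord_recr /= IHn. Qed.

Lemma exprZ (a : Z) (n : nat) : (a ^+ n)%ring = (a ^ Z.of_nat n).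
Proof.
elim: n => [//|n IHn]; rewrite exprS IHn Nat2Z.inj_succ Z.pow_succ_r //; lia.
Qed.

Lemma mulrnZ (a : Z) (n : nat) : (a *+ n)%ring = (a * Z.of_nat n).
Proof. by elim: n => [|n IHn]; rewrite ?mulr0n ?mulrS ?IHn; lia. Qed.

Lemma triangularZ (n : nat) :
  Z.of_nat 'C(n.+1, 2) = (Z.of_nat n * (Z.of_nat n + 1) / 2).
Proof.
have E : ('C(n.+1, 2) * 2 = n * n.+1)%nat.
  by elim: n => [//|n IHn]; rewrite binS bin1; lia.
by apply: (Z.div_unique _ _ _ 0); lia.
Qed.

(** The series of r times the Jacobi series is 1: the term k = 0 of the Jacobi
    series contributes r_k and the others contribute minus the right-hand side
    of the recurrence. *)
Lemma foldr_sub_shift_r (r : Z -> Z) (N : nat) (ns : seq nat) :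
  is_r_sequence r ->
  (\prod_(n <- ns) (1 - 'X^n) = qprod ('X : {poly Z}) 1 N.+1 ^+ 3)%ring ->
  forall k, (k <= N)%nat ->
  foldr sub_shift (fun i => r (Z.of_nat i)) ns k = if k is 0%nat then 1 else 0.
Proof.
move=> [r_neg [r0 r_rec]] Ens k le_kN.
rewrite (foldr_sub_shift_poly N) // Ens.
have [w ->] := Jacobi_modX ('X : {poly Z}) N.
rewrite mulrDl coefD -mulrA coefXnM ltnS le_kN addr0 mulr_suml coef_sum.
pose g (j : nat) :=
  (-1) ^ Z.of_nat j * (2 * Z.of_nat j + 1) *
  r (Z.of_nat k - Z.of_nat 'C(j.+1, 2)).
transitivity (Zsum g N.+1).
  rewrite -sum_Zsum; apply: eq_bigr => j _.
  rewrite mulrnAl coefMn -polyC1 -polyCN -polyC_exp -mulrA coefCM coefXnM.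
  rewrite mulrnZ exprZ coef_poly /g.
  case: ltnP => [lt_k|le_k]; first by rewrite r_neg; lia.
  rewrite (_ : (k - _ < _)%nat); last by lia.
  rewrite (_ : Z.of_nat (k - _) = Z.of_nat k - Z.of_nat 'C(j.+1, 2));
    last by lia.
  rewrite -[(- 1)%ring]/(-1) -[GRing.mul]/Z.mul. ring.
have g0 : g 0%nat = r (Z.of_nat k).
  by rewrite /g /= Z.sub_0_r; case: (r _).
have gS j : g j.+1 = - recurrence_term r (Z.of_nat k) j.
  rewrite /g /recurrence_term triangularZ.
  set rr := r _; rewrite Nat2Z.inj_succ Z.pow_succ_r; last by lia.
  rewrite Z.sub_1_r Z.pred_succ; ring.
have Eg n :
    Zsum g n.+1 = r (Z.of_nat k) - Zsum (recurrence_term r (Z.of_nat k)) n.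
  elim: n => [|n IHn]; first by rewrite /= g0; lia.
  by rewrite /= in IHn *; rewrite IHn gS; lia.
rewrite Eg (Zsum_stable _ k); last by apply/leP.
- case: k le_kN {g g0 gS Eg} => [|k] le_kN; first by rewrite /= r0.
  have k_ge1 : 1 <= Z.of_nat k.+1 by lia.
  have := is_series_unique _ _ (r_rec _ k_ge1).
  rewrite (is_series_unique _ _ (is_r_sequence_Zsum r r_neg _)) Nat2Z.id.
  by move/eq_IZR; lia.
- by move=> i /leP le_ki; apply: recurrence_term_vanish => //; lia.
Qed.
End Coefficients.

(** * Growth of the coefficients *)

Section Growth.
Local Open Scope R_scope.
Context (x : R) (x_gt0 : 0 < x) (x_lt1 : x < 1).

(** In terms of the bounds on a_k x^k, dividing by 1 - q^n costs at most the
    factor 1 / (1 - x^n) <= 1 + x^n / (1 - x), itself bounded by the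
    exponential; exponentials are used because the costs then multiply to the
    exponential of a geometric sum. *)
Lemma sub_shift_growth (N n : nat) (a : nat -> Z) (C : R) :
  (0 < n)%nat -> 0 <= C ->
  (forall k, (k <= N)%nat -> IZR (sub_shift n a k) * x ^ k <= C) ->
  forall k, (k <= N)%nat -> IZR (a k) * x ^ k <= C * exp (x ^ n / (1 - x)).
Proof.
move=> n_gt0 C_ge0 le_C.
have xn_gt0 : 0 < x ^ n by apply: pow_lt.
have xn_le : x ^ n <= x.
  case: n n_gt0 {le_C xn_gt0} => [//|n _] /=.
  have : x ^ n <= 1 by rewrite -(pow1 n); apply: pow_incr; lra.
  by nra.
set s := x ^ n / (1 - x).
have Es : s * (1 - x) = x ^ n by rewrite /s; field; lra.
have s_gt0 : 0 < s by apply: Rdiv_lt_0_compat; lra.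
(* Equivalent to 1 / (1 - x^n) <= 1 + s; the induction step consumes it. *)
have le_s : (1 + s) * x ^ n <= s by nra.
have le_exp : 1 + s <= exp s by apply: exp_ineq1_le.
suff le_Cs k : (k <= N)%nat -> IZR (a k) * x ^ k <= C * (1 + s).
  by move=> k le_kN; have := le_Cs k le_kN; nra.
elim/ltn_ind: k => k IHk le_kN.
have := le_C k le_kN; rewrite /sub_shift.
case: ltnP => [_|le_nk]; first by rewrite Z.sub_0_r; nra.
have lt_k : (k - n < k)%nat by lia.
have le_k : (k - n <= N)%nat by lia.
have := IHk _ lt_k le_k; rewrite minus_IZR.
have -> : x ^ k = x ^ n * x ^ (k - n).
  by rewrite -Rdef_pow_add; congr (_ ^ _); lia.
move: (IZR (a k)) (IZR (a (k - n)%nat)) (x ^ (k - n)) => u v y le_v le_u.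
have : x ^ n * (v * y) <= x ^ n * (C * (1 + s)).
  by apply: Rmult_le_compat_l; lra.
have : C * ((1 + s) * x ^ n) <= C * s by apply: Rmult_le_compat_l.
by nra.
Qed.

Lemma foldr_sub_shift_growth (N : nat) (a : nat -> Z) (ns : seq nat) (C : R) :
  all (leq 1) ns -> 0 <= C ->
  (forall k, (k <= N)%nat -> IZR (foldr sub_shift a ns k) * x ^ k <= C) ->
  forall k, (k <= N)%nat -> IZR (a k) * x ^ k <=
    C * exp (foldr (fun n S => x ^ n + S) 0 ns / (1 - x)).
Proof.
elim: ns C => [|n ns IHns] C /=.
  move=> _ _ le_C k le_kN.
  by rewrite /Rdiv Rmult_0_l exp_0 Rmult_1_r; apply: le_C.
move=> /andP [n_gt0 ns_gt0] C_ge0 le_C k le_kN.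
have le_C' := sub_shift_growth _ _ _ _ n_gt0 C_ge0 le_C.
have C'_ge0 : 0 <= C * exp (x ^ n / (1 - x)).
  by apply: Rmult_le_pos => //; apply/Rlt_le/exp_pos.
have := IHns _ ns_gt0 C'_ge0 le_C' k le_kN.
by rewrite Rmult_assoc -exp_plus Rdiv_plus_distr.
Qed.

Lemma geometric_le (m N : nat) (S : R) :
  foldr (fun n S => x ^ n + S) S (seq.iota m N) <= x ^ m / (1 - x) + S.
Proof.
elim: N m => [|N IHN] m /=.
  have : 0 < x ^ m / (1 - x) by apply: Rdiv_lt_0_compat; [apply: pow_lt | lra].
  by lra.
have -> : x ^ m / (1 - x) = x ^ m + x ^ m.+1 / (1 - x).
  by rewrite /=; field; lra.
by have := IHN m.+1; lra.
Qed.
End Growth.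

(** * Radius of convergence and monotonicity *)

Lemma CV_radius_eq1 (a : nat -> R) :
  (forall k, 1 <= a k)%R ->
  (forall x, (0 < x < 1)%R -> exists M, forall k, (a k * x ^ k <= M)%R) ->
  CV_radius a = Finite 1.
Proof.
move=> a_ge1 a_bound.
have [ub lub] := CV_radius_bounded a.
apply: Rbar_le_antisym.
- apply: lub => y [M le_M] /=.
  case: (Rle_lt_dec y 1) => // y_gt1; exfalso.
  have y_abs : (Rabs y > 1)%R by rewrite Rabs_pos_eq; lra.
  have [k0 Hk] := Pow_x_infinity y y_abs (M + 1)%R.
  have := Hk k0 (Nat.le_refl _); have := le_M k0; rewrite Rabs_mult.
  rewrite (Rabs_pos_eq (a k0)); last by have := a_ge1 k0; lra.
  by have := a_ge1 k0; have := Rabs_pos (y ^ k0)%R; nra.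
- have ge_x x : (0 < x < 1)%R -> Rbar_le x (CV_radius a).
    move=> x01; apply: ub; have [M le_M] := a_bound x x01.
    exists M => k; rewrite Rabs_pos_eq //.
    by apply: Rmult_le_pos; [have := a_ge1 k; lra | apply: pow_le; lra].
  case: (CV_radius a) ge_x => [c||] ge_x //=; last first.
    by have := ge_x (1 / 2)%R; apply; lra.
  case: (Rle_lt_dec 1 c) => // c_lt1; exfalso.
  have /= h2 := ge_x (1 / 2)%R; have := h2 ltac:(lra) => hc.
  by have /= := ge_x ((1 + c) / 2)%R ltac:(lra); lra.
Qed.

Lemma increasing_from_step (m : Z) (f : Z -> Z) :
  (forall k, (m <= k)%Z -> (f k < f (k + 1))%Z) -> increasing_from m f.
Proof.
move=> f_lt j k le_mj lt_jk.
have -> : k = (j + 1 + Z.of_nat (Z.to_nat (k - j - 1)))%Z by lia.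
elim: (Z.to_nat _) => [|n IHn]; first by rewrite Z.add_0_r; apply: f_lt.
rewrite Nat2Z.inj_succ -Z.add_1_r Z.add_assoc.
by apply: Z.lt_trans IHn _; apply: f_lt; lia.
Qed.

Lemma ge1_step (m : Z) (f : Z -> Z) :
  (1 <= f m)%Z -> (forall k, (m <= k)%Z -> (f k <= f (k + 1))%Z) ->
  forall k, (m <= k)%Z -> (1 <= f k)%Z.
Proof.
move=> fm f_le k le_mk.
have -> : k = (m + Z.of_nat (Z.to_nat (k - m)))%Z by lia.
elim: (Z.to_nat _) => [|n IHn]; first by rewrite Z.add_0_r.
rewrite Nat2Z.inj_succ -Z.add_1_r Z.add_assoc.
by apply: Z.le_trans IHn _; apply: f_le; lia.
Qed.

(** The third differences of r are the coefficients of the product of the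
    (1 - q^n)^(-3) over n >= 2, to which [foldr_sub_shift_gt0] applies. The
    coefficient of q^1 vanishes, hence the condition on k. *)
Lemma third_difference (r : Z -> Z) (k : nat) : is_r_sequence r ->
  let d := (r (Z.of_nat k) - 3 * r (Z.of_nat k - 1) + 3 * r (Z.of_nat k - 2)
            - r (Z.of_nat k - 3))%Z in
  (0 <= d)%Z /\ ((1 < k)%nat -> (1 <= d)%Z).
Proof.
move=> hr; have r_neg := proj1 hr; move=> d.
set a3 := foldr sub_shift (fun i => r (Z.of_nat i)) [:: 1; 1; 1]%nat.
have -> : d = a3 k.
  pose f1 j := (r j - r (j - 1))%Z; pose f2 j := (f1 j - f1 (j - 1))%Z.
  have f1_neg j : (j < 0)%Z -> f1 j = 0%Z by move=> ?; rewrite /f1 !r_neg; lia.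
  have f2_neg j : (j < 0)%Z -> f2 j = 0%Z by move=> ?; rewrite /f2 !f1_neg; lia.
  have ext (b c : nat -> Z) : b =1 c -> sub_shift 1 b =1 sub_shift 1 c.
    by move=> Ebc i; rewrite /sub_shift !Ebc.
  have E1 : sub_shift 1 (fun i => r (Z.of_nat i)) =1 fun i => f1 (Z.of_nat i).
    by move=> i; apply: sub_shift1.
  have E2 : sub_shift 1 (fun i => f1 (Z.of_nat i)) =1 fun i => f2 (Z.of_nat i).
    by move=> i; apply: sub_shift1.
  rewrite /d /a3 [foldr _ _ _]/= (ext _ _ (ext _ _ E1)) (ext _ _ E2) sub_shift1 //.
  rewrite /f2 /f1.
  rewrite (_ : Z.of_nat k - 2 = Z.of_nat k - 1 - 1)%Z; last by lia.
  by rewrite (_ : Z.of_nat k - 3 = Z.of_nat k - 1 - 1 - 1)%Z; lia.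
set s := index_iota 2 k.+1; pose ns := s ++ s ++ s.
have s_gt0 : all (leq 1) s.
  by apply/allP => i; rewrite mem_index_iota => /andP [Hi _]; lia.
have ns_gt0 : all (leq 1) ns by rewrite !all_cat s_gt0.
have E i : (i <= k)%nat ->
    foldr sub_shift a3 ns i = if i is 0%nat then 1%Z else 0%Z.
  (* For k = 0 the factor n = 1 is not among the 1 - q^n with 1 <= n <= k. *)
  case: (posnP k) => [k0|k_gt0] le_ik.
    have -> : i = 0%nat by lia.
    rewrite /ns /s k0 /= /a3 /= /sub_shift /=; have := proj1 (proj2 hr); lia.
  rewrite /a3 -foldr_cat; apply: (foldr_sub_shift_r _ k) => //.
  by rewrite -!catA; apply: prod_triple_tail.
have ge0 i : (i <= k)%nat -> (0 <= foldr sub_shift a3 ns i)%Z.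
  by move=> /E ->; case: i.
split=> [|k_gt1].
  apply: Z.le_trans (ge0 _ (leqnn k)) _.
  exact: (foldr_sub_shift_le _ _ _ ns_gt0 ge0 _ (leqnn k)).
apply: (foldr_sub_shift_gt0 k _ ns) => //; first by rewrite E.
by rewrite !mem_cat mem_index_iota k_gt1 ltnSn.
Qed.

Lemma r_growth (r : Z -> Z) (x : R) : is_r_sequence r -> (0 < x < 1)%R ->
  forall k, (IZR (r (Z.of_nat k)) * x ^ k <= exp (3 * x / (1 - x) ^ 2))%R.
Proof.
move=> hr [x_gt0 x_lt1] k.
set s := index_iota 1 k.+1; pose ns := s ++ s ++ s.
have s_gt0 : all (leq 1) s.
  by apply/allP => i; rewrite mem_index_iota => /andP [Hi _]; lia.
have ns_gt0 : all (leq 1) ns by rewrite !all_cat s_gt0.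
have E i : (i <= k)%nat ->
    (IZR (foldr sub_shift (fun i => r (Z.of_nat i)) ns i) * x ^ i <= 1)%R.
  move=> le_ik; rewrite (foldr_sub_shift_r _ k) //.
    by case: i {le_ik} => [|i] /=; lra.
  exact: prod_triple.
apply: Rle_trans (foldr_sub_shift_growth x x_gt0 x_lt1
  _ _ _ _ ns_gt0 Rle_0_1 E _ (leqnn k)) _.
have exp_le u v : (u <= v)%R -> (exp u <= exp v)%R.
  by case=> [/exp_increasing /Rlt_le | ->] //; apply: Rle_refl.
rewrite Rmult_1_l; apply: exp_le.
rewrite !foldr_cat.
pose sum S := foldr (fun n S => x ^ n + S)%R S s.
have h1 := geometric_le x x_gt0 x_lt1 1 k 0.
have h2 := geometric_le x x_gt0 x_lt1 1 k (sum 0%R).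
have h3 := geometric_le x x_gt0 x_lt1 1 k (sum (sum 0%R)).
have -> : (3 * x / (1 - x) ^ 2 =
    (x ^ 1 / (1 - x) + (x ^ 1 / (1 - x) + (x ^ 1 / (1 - x) + 0))) / (1 - x))%R.
  by field; lra.
apply: Rmult_le_compat_r; first by apply/Rlt_le/Rinv_0_lt_compat; lra.
rewrite /sum /s /index_iota subn1 /= in h1 h2 h3 *; lra.
Qed.

Theorem proposition3 (r : Z -> Z) (hr : is_r_sequence r) :
  (increasing_from 0 (fun k : Z => r k) /\
   increasing_from 0 (fun k : Z => (r (k + 1) - r k)%Z) /\
   increasing_from 1 (fun k : Z => (r (k + 2) - 2 * r (k + 1) + r k)%Z)) /\
  CV_radius (fun k : nat => match k with
                            | O => 1%R
                            | S _ => IZR (r (Z.of_nat k))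
                            end) = Finite 1.
Proof.
have [r_neg [r0 _]] := hr.
pose d1 k := (r (k + 1) - r k)%Z.
pose d2 k := (r (k + 2) - 2 * r (k + 1) + r k)%Z.
(* Starting at negative indices, where r vanishes, avoids computing initial
   values of r beyond r 0. *)
have d2_step k : (-3 <= k)%Z -> (0 <= d2 (k + 1) - d2 k)%Z /\
    ((-2 < k)%Z -> (1 <= d2 (k + 1) - d2 k)%Z).
  move=> le_k; have := third_difference r (Z.to_nat (k + 3)) hr.
  have -> : Z.of_nat (Z.to_nat (k + 3)) = (k + 3)%Z by lia.
  cbv zeta; rewrite /d2.
  have -> : (k + 3 - 1 = k + 2)%Z by lia.
  have -> : (k + 3 - 2 = k + 1)%Z by lia.
  have -> : (k + 3 - 3 = k)%Z by lia.
  have -> : (k + 1 + 2 = k + 3)%Z by lia.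
  have -> : (k + 1 + 1 = k + 2)%Z by lia.
  by move=> [ge0 ge1]; split=> [|lt_k]; [lia | have := ge1 ltac:(lia); lia].
have d2_ge1 : forall k, (-2 <= k)%Z -> (1 <= d2 k)%Z.
  apply: ge1_step; first by rewrite /d2 /= r0 !r_neg.
  by move=> k le_k; have := proj1 (d2_step k ltac:(lia)); lia.
have d1_step k : (d1 (k + 1) - d1 k = d2 k)%Z.
  by rewrite /d1 /d2 (_ : k + 1 + 1 = k + 2)%Z; lia.
have d1_ge1 : forall k, (-1 <= k)%Z -> (1 <= d1 k)%Z.
  apply: ge1_step; first by rewrite /d1 /= r0 r_neg.
  by move=> k le_k; have := d1_step k; have := d2_ge1 k ltac:(lia); lia.
split; [split; [|split]|].
- apply: increasing_from_step => k le_k.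
  by have := d1_ge1 k ltac:(lia); rewrite /d1; lia.
- apply: (increasing_from_step 0 d1) => k le_k.
  by have := d1_step k; have := d2_ge1 k ltac:(lia); lia.
- apply: (increasing_from_step 1 d2) => k le_k.
  by have := proj2 (d2_step k ltac:(lia)) ltac:(lia); lia.
rewrite (CV_radius_ext _ (fun k => IZR (r (Z.of_nat k)))); last first.
  by case => [|k] //=; rewrite r0.
apply: CV_radius_eq1.
  move=> k; apply: (IZR_le 1); move: (Z.of_nat k) (Nat2Z.is_nonneg k).
  apply: ge1_step; first by rewrite r0.
  by move=> j le_j; have := d1_ge1 j ltac:(lia); rewrite /d1; lia.
by move=> x x01; exists (exp (3 * x / (1 - x) ^ 2)); apply: r_growth.
Qed.
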